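(* The sequence $(\theta_n)_{n\in\mathbb{N}}$ is strictly increasing, i.e. $\theta_n < \theta_{n+1}$ for every integer $n\geq 1$.
   Context: $\mathbb{N}$ denotes the set of positive integers. For each $n\in\mathbb{N}$, the real number $\theta_n$ is the correction term defined by the equation $$n! = \sqrt{\pi}\,\Bigl(\frac{n}{e}\Bigr)^n \Bigl(8n^3+4n^2+n+\frac{\theta_n}{30}\Bigr)^{1/6},$$ equivalently $$\theta_n = 30\left(\left(\frac{n!}{\sqrt{\pi}\,(n/e)^n}\right)^6 - 8n^3-4n^2-n\right).$$ *)

(* Defs.v *)
(* World: Stdlib (classical real numbers). *)
From Stdlib Require Import Reals Factorial Lra Lia.
Open Scope R_scope.

(* The defining equation of theta_n solved for theta_n; meaningful for n >= 1. *)
Definition theta (n : nat) : R :=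
  30 * ((INR (fact n) / (sqrt PI * (INR n / exp 1) ^ n)) ^ 6
        - 8 * INR n ^ 3 - 4 * INR n ^ 2 - INR n).

(* theta_n satisfies the defining equation, with a positive radicand, so that
   [Rpower _ (1 / 6)] is the genuine sixth root. *)
Lemma theta_spec (n : nat) : (1 <= n)%nat ->
  0 < 8 * INR n ^ 3 + 4 * INR n ^ 2 + INR n + theta n / 30 /\
  INR (fact n) =
    sqrt PI * (INR n / exp 1) ^ n *
    Rpower (8 * INR n ^ 3 + 4 * INR n ^ 2 + INR n + theta n / 30) (1 / 6).
Proof.
intros Hn.
assert (Hd : 0 < sqrt PI * (INR n / exp 1) ^ n).
{ apply Rmult_lt_0_compat; [apply sqrt_lt_R0, PI_RGT_0|].
  apply pow_lt, Rdiv_lt_0_compat; [apply lt_0_INR; lia|apply exp_pos]. }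
set (d := sqrt PI * (INR n / exp 1) ^ n) in *.
assert (Hq : 0 < INR (fact n) / d)
  by (apply Rdiv_lt_0_compat; [apply INR_fact_lt_0|exact Hd]).
assert (E : 8 * INR n ^ 3 + 4 * INR n ^ 2 + INR n + theta n / 30
            = (INR (fact n) / d) ^ 6) by (unfold theta; fold d; lra).
rewrite E; split; [now apply pow_lt|].
rewrite <- (Rpower_pow 6 _ Hq), Rpower_mult.
replace (INR 6 * (1 / 6)) with 1 by (simpl; lra).
rewrite Rpower_1 by exact Hq.
field; lra.
Qed.

(* Main.v *)
Require Import Defs.
From Stdlib Require Import Reals Factorial Lra Lia.
From Coquelicot Require Import Coquelicot.
Open Scope R_scope.

(** Put w_n = (n! / (sqrt pi (n/e)^n))^6. The ratio q_n = w_{n+1} / w_n =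
    (e (n/(n+1))^n)^6 is explicit, so theta_n < theta_{n+1} amounts to
    w_n (q_n - 1) > 24 n^2 + 32 n + 13, which only needs lower bounds for w_n and
    q_n. Writing w_n = 8 n^3 exp (6 X_n), Wallis' inequality gives
    2 X_n >= X_{2n}, hence X_n >= 0, and telescoping
    X_n - X_{n+1} = (n + 1/2) log (1 + 1/n) - 1 upgrades this to the first terms of
    the Stirling series. With polynomial minorants in x = 1/n the claim becomes a
    polynomial inequality on (0, 1/3]. *)

Lemma exp_le (x y : R) : x <= y -> exp x <= exp y.
Proof.
intros [H| ->]; [now apply Rlt_le, exp_increasing|apply Rle_refl].
Qed.

Lemma le_of_derive_nonneg (f f' : R -> R) (a b : R) : a <= b ->
  (forall x, a <= x <= b -> is_derive f x (f' x)) ->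
  (forall x, a <= x <= b -> 0 <= f' x) -> f a <= f b.
Proof.
intros Hab Hd Hpos.
destruct (MVT_gen f a b f') as [c [Hc E]].
- intros x Hx; rewrite Rmin_left, Rmax_right in Hx by lra; apply Hd; lra.
- intros x Hx; rewrite Rmin_left, Rmax_right in Hx by lra.
  apply continuity_pt_filterlim, (ex_derive_continuous (V := R_NormedModule)).
  exists (f' x); apply Hd; lra.
- rewrite Rmin_left, Rmax_right in Hc by lra.
  assert (0 <= f' c * (b - a)) by (apply Rmult_le_pos; [apply Hpos|]; lra).
  lra.
Qed.

(* The first three terms of the Stirling series of log n! in x = 1/n, with 1/1260
   lowered to 1/1600 so that [log1p_lower] holds without further terms. *)
Definition log_minorant (x : R) : R := x / 12 - x ^ 3 / 360 + x ^ 5 / 1600.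

(* Expansion of [exp (6 * log_minorant x)], last coefficient lowered. *)
Definition stirling_minorant (x : R) : R :=
  1 + x / 2 + x ^ 2 / 8 + x ^ 3 / 240 - 11 / 1920 * x ^ 4 + 3 / 1600 * x ^ 5.

(* Expansion of [exp (6 - 6 * (ln (1 + x) / x))], last coefficient lowered. *)
Definition ratio_minorant (x : R) : R :=
  1 + 3 * x + 5 / 2 * x ^ 2 - 13 / 40 * x ^ 4 + 7 / 40 * x ^ 5
  - 53 / 1000 * x ^ 6.

(* On [0, 1/3] each power is at most a third of the previous one; with these
   facts the polynomial inequalities below become linear. *)
Lemma pow_step (x : R) (k : nat) : 0 <= x <= 1 / 3 ->
  0 <= x ^ k /\ x ^ S k <= x ^ k / 3.
Proof.
intros Hx; split; [now apply pow_le|].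
assert (0 <= x ^ k) by now apply pow_le.
simpl; nra.
Qed.

Lemma inv_INR_third (n : nat) : (3 <= n)%nat -> 0 < / INR n <= 1 / 3.
Proof.
intros Hn; assert (H : INR 3 <= INR n) by now apply le_INR.
simpl in H; split; [apply Rinv_0_lt_compat; lra|].
replace (1 / 3) with (/ 3) by lra; apply Rinv_le_contravar; lra.
Qed.

Lemma inv_INR_one (n : nat) : (1 <= n)%nat -> 0 < / INR n <= 1.
Proof.
intros Hn; assert (H : INR 1 <= INR n) by now apply le_INR.
simpl in H; split; [apply Rinv_0_lt_compat; lra|].
rewrite <- Rinv_1; apply Rinv_le_contravar; lra.
Qed.

Ltac poly_third x Hx :=
  pose proof (pow_step x 0 Hx); pose proof (pow_step x 1 Hx);
  pose proof (pow_step x 2 Hx); pose proof (pow_step x 3 Hx);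
  pose proof (pow_step x 4 Hx); pose proof (pow_step x 5 Hx);
  pose proof (pow_step x 6 Hx); pose proof (pow_step x 7 Hx);
  pose proof (pow_step x 8 Hx); pose proof (pow_step x 9 Hx);
  pose proof (pow_step x 10 Hx); pose proof (pow_step x 11 Hx);
  pose proof (pow_step x 12 Hx); pose proof (pow_step x 13 Hx);
  pose proof (pow_step x 14 Hx); pose proof (pow_step x 15 Hx);
  pose proof (pow_step x 16 Hx);
  cbv [pow] in *; lra.

Lemma is_derive_log_minorant (x : R) :
  is_derive log_minorant x (1 / 12 - x ^ 2 / 120 + x ^ 4 / 320).
Proof. unfold log_minorant; auto_derive; [easy|field]. Qed.

(* Eta-expanded, which is the form that [auto_derive] leaves. *)
Lemma Derive_log_minorant (x : R) :
  Derive (fun y => log_minorant y) x = 1 / 12 - x ^ 2 / 120 + x ^ 4 / 320.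
Proof. exact (is_derive_unique _ _ _ (is_derive_log_minorant x)). Qed.

Lemma stirling_minorant_le_exp (x : R) : 0 <= x <= 1 / 3 -> stirling_minorant x <=
  exp (6 * log_minorant x).
Proof.
intros Hx.
set (g' := fun y : R => 1 / 2 - y ^ 2 / 20 + 3 * y ^ 4 / 160).
set (s' := fun y : R => 1 / 2 + y / 4 + y ^ 2 / 80 - 11 / 480 * y ^ 3
                        + 3 / 320 * y ^ 4).
assert (H : - (stirling_minorant 0 * exp (- (6 * log_minorant 0))) <=
  - (stirling_minorant x * exp (- (6 * log_minorant x)))).
{ apply (le_of_derive_nonneg (fun y => - (stirling_minorant y * exp (- (6 *
  log_minorant y))))
           (fun y => (g' y * stirling_minorant y - s' y) * exp (- (6 *
             log_minorant y)))); [lra| |].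
  - intros y Hy; unfold stirling_minorant, g', s'; auto_derive.
    + repeat split; eexists; apply is_derive_log_minorant.
    + rewrite Derive_log_minorant; field.
  - intros y Hy; apply Rmult_le_pos; [|apply Rlt_le, exp_pos].
    assert (Hy' : 0 <= y <= 1 / 3) by lra.
    unfold g', s', stirling_minorant. poly_third y Hy'. }
replace (stirling_minorant 0 * exp (- (6 * log_minorant 0))) with 1 in H.
2:{ replace (- (6 * log_minorant 0)) with 0 by (unfold log_minorant; field).
    rewrite exp_0; unfold stirling_minorant; field. }
rewrite exp_Ropp in H.
assert (Hp := exp_pos (6 * log_minorant x)).
apply Rmult_le_reg_r with (/ exp (6 * log_minorant x)); [now apply Rinv_0_lt_compat|].
rewrite Rinv_r by lra; lra.
Qed.

Lemma ratio_minorant_pos (x : R) : 0 <= x <= 1 / 3 -> 0 < ratio_minorant x.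
Proof. intros Hx; unfold ratio_minorant; poly_third x Hx. Qed.

Lemma ratio_minorant_le_exp (x : R) : 0 < x <= 1 / 3 -> ratio_minorant x <=
  exp (6 - 6 * (ln (1 + x) / x)).
Proof.
intros Hx.
set (p' := fun y : R => 3 + 5 * y - 13 / 10 * y ^ 3 + 7 / 8 * y ^ 4
                        - 159 / 500 * y ^ 5).
set (p'' := fun y : R => 5 - 39 / 10 * y ^ 2 + 7 / 2 * y ^ 3
                        - 159 / 100 * y ^ 4).
assert (Dp : forall y, is_derive ratio_minorant y (p' y)).
{ intros y; unfold ratio_minorant, p'; auto_derive; [easy|field]. }
assert (Dp' : forall y, is_derive p' y (p'' y)).
{ intros y; unfold p', p''; auto_derive; [easy|field]. }
assert (Ep : forall y, Derive (fun z => ratio_minorant z) y = p' y)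
  by exact (fun y => is_derive_unique _ _ _ (Dp y)).
assert (Ep' : forall y, Derive (fun z => p' z) y = p'' y)
  by exact (fun y => is_derive_unique _ _ _ (Dp' y)).
(* [h] is x times the difference of the logarithms; two derivatives remove
   every logarithm. *)
set (h := fun y => 6 * y - 6 * ln (1 + y) - y * ln (ratio_minorant y)).
set (h' := fun y => 6 - 6 / (1 + y) - ln (ratio_minorant y) - y *
  p' y / ratio_minorant y).
set (h'' := fun y => (6 * (ratio_minorant y) ^ 2 - (1 + y) ^ 2 * (2 * p' y *
  ratio_minorant y
                + y * (p'' y * ratio_minorant y - (p' y) ^ 2))) / ((1 + y) ^ 2 *
                  (ratio_minorant y) ^ 2)).
assert (Dh : forall y, 0 <= y <= 1 / 3 -> is_derive h y (h' y)).
{ intros y Hy; assert (Hp := ratio_minorant_pos y Hy); unfold h, h'; auto_derive.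
  - repeat split; try lra. now exists (p' y).
  - rewrite Ep; field; lra. }
assert (Dh' : forall y, 0 <= y <= 1 / 3 -> is_derive h' y (h'' y)).
{ intros y Hy; assert (Hp := ratio_minorant_pos y Hy); unfold h', h''; auto_derive.
  - repeat split; try lra; try (now exists (p' y)); now exists (p'' y).
  - rewrite Ep, Ep'; field; lra. }
assert (Hh'' : forall y, 0 <= y <= 1 / 3 -> 0 <= h'' y).
{ intros y Hy; assert (Hp := ratio_minorant_pos y Hy); unfold h''.
  apply Rdiv_le_0_compat; [|apply Rmult_lt_0_compat; apply pow_lt; lra].
  unfold ratio_minorant, p', p''; poly_third y Hy. }
assert (p0 : ratio_minorant 0 = 1) by (unfold ratio_minorant; field).
assert (Hh' : forall y, 0 <= y <= 1 / 3 -> 0 <= h' y).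
{ intros y Hy; replace 0 with (h' 0) at 1.
  - apply (le_of_derive_nonneg h' h''); [lra| |];
      intros z Hz; [apply Dh'|apply Hh'']; lra.
  - unfold h'; rewrite p0, ln_1; field. }
assert (Hh : h 0 <= h x).
{ apply (le_of_derive_nonneg h h'); [lra| |];
    intros z Hz; [apply Dh|apply Hh']; lra. }
unfold h in Hh; rewrite p0, Rplus_0_r, ln_1 in Hh.
assert (Hp : 0 < ratio_minorant x) by (apply ratio_minorant_pos; lra).
rewrite <- (exp_ln (ratio_minorant x)) by exact Hp.
apply exp_le, Rmult_le_reg_l with x; [lra|].
replace (x * (6 - 6 * (ln (1 + x) / x))) with (6 * x - 6 * ln (1 + x))
  by (field; lra); lra.
Qed.

Lemma minorants_suffice (x : R) : 0 < x <= 1 / 3 ->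
  24 * x + 32 * x ^ 2 + 13 * x ^ 3 < 8 * (stirling_minorant x * (ratio_minorant x - 1)).
Proof.
intros Hx; assert (Hx' : 0 <= x <= 1 / 3) by lra.
assert (0 < x ^ 5) by (apply pow_lt; lra).
unfold stirling_minorant, ratio_minorant; poly_third x Hx'.
Qed.

Definition log1p_minorant (x : R) : R := (1 + log_minorant x - log_minorant (x / (1 +
  x))) * (2 * x / (2 + x)).

Lemma log1p_lower (x : R) : 0 < x <= 1 / 3 ->
  log_minorant x - log_minorant (x / (1 + x)) <= (/ x + 1 / 2) * ln (1 + x) - 1.
Proof.
intros Hx.
assert (H : ln (1 + 0) - log1p_minorant 0 <= ln (1 + x) - log1p_minorant x).
{ apply (le_of_derive_nonneg (fun y => ln (1 + y) - log1p_minorant y)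
    (fun y => / (1 + y)
     - (1 / 12 - y ^ 2 / 120 + y ^ 4 / 320
        - (1 / 12 - (y / (1 + y)) ^ 2 / 120 + (y / (1 + y)) ^ 4 / 320)
          / (1 + y) ^ 2) * (2 * y / (2 + y))
     - (1 + log_minorant y - log_minorant (y / (1 + y))) * (4 / (2 + y) ^ 2)));
       [lra| |].
  - intros y Hy; unfold log1p_minorant; auto_derive.
    + repeat split; try lra; eexists; apply is_derive_log_minorant.
    + rewrite !Derive_log_minorant; unfold Rdiv, Rminus; field; lra.
  - intros y Hy; assert (Hy' : 0 <= y <= 1 / 3) by lra.
    unfold log_minorant.
    match goal with |- 0 <= ?e =>
      replace e with ((e * ((1 + y) ^ 6 * (2 + y) ^ 2)) / ((1 + y) ^ 6 * (2 + y) ^ 2))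
        by (field; lra) end.
    apply Rdiv_le_0_compat; [|apply Rmult_lt_0_compat; apply pow_lt; lra].
    field_simplify; [|lra].
    poly_third y Hy'. }
assert (E : ln (1 + 0) - log1p_minorant 0 = 0).
{ unfold log1p_minorant, log_minorant; rewrite Rplus_0_r, ln_1; field. }
rewrite E in H; unfold log1p_minorant in H.
replace (log_minorant x - log_minorant (x / (1 + x))) with
  ((1 + log_minorant x - log_minorant (x / (1 + x))) * (2 * x / (2 + x)) * (/ x +
    1 / 2) - 1)
  by (field; lra).
assert (0 < / x) by (apply Rinv_0_lt_compat; lra).
rewrite (Rmult_comm (/ x + 1 / 2)).
apply Rplus_le_compat_r, Rmult_le_compat_r; lra.
Qed.

Lemma log1p_upper (x : R) : 0 < x <= 1 ->
  (/ x + 1 / 2) * ln (1 + x) - 1 <= x - x / (1 + x).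
Proof.
intros Hx.
set (U := fun y : R => 2 * y / (2 + y) * (1 + (y - y / (1 + y)))).
assert (H : U 0 - ln (1 + 0) <= U x - ln (1 + x)).
{ apply (le_of_derive_nonneg (fun y => U y - ln (1 + y))
    (fun y => y ^ 2 * (11 + 11 * y + 2 * y ^ 2)
              / ((1 + y) ^ 2 * (2 + y) ^ 2))); [lra| |].
  - intros y Hy; unfold U; auto_derive; [repeat split; lra|field; lra].
  - intros y Hy.
    apply Rdiv_le_0_compat; [|apply Rmult_lt_0_compat; apply pow_lt; lra].
    apply Rmult_le_pos; nra. }
assert (E : U 0 - ln (1 + 0) = 0) by (rewrite Rplus_0_r, ln_1; unfold U; field).
rewrite E in H.
replace (x - x / (1 + x)) with ((/ x + 1 / 2) * U x - 1) by (unfold U; field; lra).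
assert (0 < / x) by (apply Rinv_0_lt_compat; lra).
apply Rplus_le_compat_r, Rmult_le_compat_l; lra.
Qed.

Definition wallis (n : nat) : R := RInt (fun x => sin x ^ n) 0 (PI / 2).

Lemma continuous_sin_pow (n : nat) (x : R) : continuous (fun y => sin y ^ n) x.
Proof. apply (ex_derive_continuous (V := R_NormedModule)); auto_derive; easy. Qed.

Lemma ex_RInt_sin_pow (n : nat) (a b : R) : ex_RInt (fun x => sin x ^ n) a b.
Proof. apply (ex_RInt_continuous (V := R_CompleteNormedModule)); intros;
  apply continuous_sin_pow. Qed.

Lemma wallis_0 : wallis 0 = PI / 2.
Proof.
unfold wallis; rewrite (RInt_ext _ (fun _ => 1)) by easy.
rewrite RInt_const; unfold scal; simpl; unfold mult; simpl; ring.
Qed.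

Lemma wallis_1 : wallis 1 = 1.
Proof.
apply is_RInt_unique.
replace 1 with (minus (- cos (PI / 2)) (- cos 0)).
2:{ rewrite cos_PI2, cos_0; unfold minus, plus, opp; simpl; ring. }
apply (is_RInt_derive (fun x => - cos x) (fun x => sin x ^ 1)).
- intros x _; auto_derive; [easy|ring].
- intros x _; apply continuous_sin_pow.
Qed.

Lemma wallis_rec (n : nat) : (INR n + 2) * wallis (S (S n)) = (INR n + 1) * wallis n.
Proof.
assert (H : is_RInt (fun x => (INR n + 2) * sin x ^ S (S n) - (INR n + 1) * sin x ^ n)
          0 (PI / 2)
          (minus (- cos (PI / 2) * sin (PI / 2) ^ S n) (- cos 0 * sin 0 ^ S n))).
{ apply (is_RInt_derive (fun x => - cos x * sin x ^ S n)).
  - intros x _; auto_derive; [easy|].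
    assert (E := sin2_cos2 x); unfold Rsqr in E.
    change (match n with O => 1 | S _ => INR n + 1 end) with (INR (S n)).
    rewrite S_INR; simpl pred.
    replace (sin x ^ S (S n)) with (sin x * sin x * sin x ^ n) by (simpl; ring).
    replace (sin x ^ S n) with (sin x * sin x ^ n) by (simpl; ring).
    replace (cos x * (1 * cos x)) with (cos x * cos x) by ring.
    assert (E' : cos x * cos x = 1 - sin x * sin x) by lra.
    ring_simplify.
    replace (cos x ^ 2) with (1 - sin x * sin x) by (rewrite <- E'; ring).
    ring.
  - intros x _; apply (ex_derive_continuous (V := R_NormedModule)); auto_derive; easy. }
rewrite cos_PI2, sin_0 in H.
assert (H' := is_RInt_unique _ _ _ _ H).
assert (HL : is_RInt (fun x => (INR n + 2) * sin x ^ S (S n) - (INR n + 1) * sin x ^ n)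
          0 (PI / 2) ((INR n + 2) * wallis (S (S n)) - (INR n + 1) * wallis n)).
{ apply (is_RInt_minus (V := R_NormedModule) (fun x => (INR n + 2) * sin x ^ S (S n))
           (fun x => (INR n + 1) * sin x ^ n));
    apply (is_RInt_scal (V := R_NormedModule));
    apply (RInt_correct (V := R_CompleteNormedModule)), ex_RInt_sin_pow. }
assert (HL' := is_RInt_unique _ _ _ _ HL).
rewrite H' in HL'; unfold minus, plus, opp in HL'; simpl in HL'.
simpl; lra.
Qed.

Lemma wallis_decr (n : nat) : wallis (S n) <= wallis n.
Proof.
apply RInt_le; [pose proof PI_RGT_0; lra|apply ex_RInt_sin_pow..|].
intros x Hx.
assert (0 <= sin x) by (apply sin_ge_0; lra).
assert (0 <= sin x ^ n) by now apply pow_le.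
assert (H1 := SIN_bound x); simpl; nra.
Qed.

Lemma wallis_nonneg (n : nat) : 0 <= wallis n.
Proof.
apply RInt_ge_0; [pose proof PI_RGT_0; lra|apply ex_RInt_sin_pow|].
intros x Hx; apply pow_le, sin_ge_0; lra.
Qed.

Lemma wallis_mul_succ (n : nat) : (INR n + 1) * (wallis (S n) * wallis n) = PI / 2.
Proof.
induction n as [|n IH].
- rewrite wallis_0, wallis_1; simpl; field.
- rewrite S_INR, <- IH; assert (H := wallis_rec n).
  replace ((INR n + 1 + 1) * (wallis (S (S n)) * wallis (S n)))
    with ((INR n + 2) * wallis (S (S n)) * wallis (S n)) by ring.
  rewrite H; ring.
Qed.

Lemma wallis_even (n : nat) :
  wallis (2 * n) * (4 ^ n * INR (fact n) ^ 2) = PI / 2 * INR (fact (2 * n)).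
Proof.
induction n as [|n IH].
- change (2 * 0)%nat with 0%nat; rewrite wallis_0; simpl; field.
- replace (2 * S n)%nat with (S (S (2 * n))) by lia.
  assert (H := wallis_rec (2 * n)).
  assert (E2 : INR (2 * n) = 2 * INR n) by now rewrite mult_INR.
  rewrite !fact_simpl, 3!mult_INR, !S_INR; rewrite E2 in H.
  assert (Hn := pos_INR n).
  apply Rmult_eq_reg_l with (2 * INR n + 2); [|lra].
  replace ((2 * INR n + 2) * (wallis (S (S (2 * n))) * (4 ^ S n * ((INR n + 1) *
    INR (fact n)) ^ 2)))
   with (((2 * INR n + 2) * wallis (S (S (2 * n)))) * (4 * (INR n + 1) ^ 2 * (4 ^ n *
     INR (fact n) ^ 2))) by (change (4 ^ S n) with (4 * 4 ^ n); ring).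
  rewrite H.
  replace ((2 * INR n + 1) * wallis (2 * n) * (4 * (INR n + 1) ^ 2 * (4 ^ n *
    INR (fact n) ^ 2)))
   with ((2 * INR n + 1) * 4 * (INR n + 1) ^ 2 * (wallis (2 * n) * (4 ^ n *
     INR (fact n) ^ 2))) by ring.
  rewrite IH, E2; field.
Qed.

Lemma wallis_factorial (n : nat) : (1 <= n)%nat ->
  PI * INR n * INR (fact (2 * n)) ^ 2 <= 16 ^ n * INR (fact n) ^ 4.
Proof.
intros Hn.
assert (Hn0 : 0 < INR n) by (apply lt_0_INR; lia).
assert (Hpi := PI_RGT_0).
assert (E := wallis_even n).
assert (B : 2 * INR n * wallis (2 * n) ^ 2 <= PI / 2).
{ destruct n as [|m]; [lia|].
  replace (2 * S m)%nat with (S (S (2 * m))) in * by lia.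
  assert (H := wallis_mul_succ (S (2 * m))).
  assert (Hd := wallis_decr (S (2 * m))).
  assert (Hp := wallis_nonneg (S (S (2 * m)))).
  rewrite S_INR, mult_INR in H; change (INR 2) with 2 in H.
  rewrite S_INR in *; rewrite <- H.
  assert (wallis (S (S (2 * m))) ^ 2 <= wallis (S (S (2 * m))) * wallis (S (2 *
    m))) by nra.
  nra. }
assert (E2 : wallis (2 * n) ^ 2 * (16 ^ n * INR (fact n) ^ 4)
             = PI ^ 2 / 4 * INR (fact (2 * n)) ^ 2).
{ replace (16 ^ n) with (4 ^ n * 4 ^ n) by (rewrite <- Rpow_mult_distr; f_equal; lra).
  transitivity ((wallis (2 * n) * (4 ^ n * INR (fact n) ^ 2)) ^ 2); [ring|].
  rewrite E; field. }
set (K := 16 ^ n * INR (fact n) ^ 4) in *.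
assert (0 <= K) by (apply Rmult_le_pos; apply pow_le; [lra|apply pos_INR]).
apply Rmult_le_reg_l with (PI / 2); [lra|].
replace (PI / 2 * (PI * INR n * INR (fact (2 * n)) ^ 2))
  with (2 * INR n * (PI ^ 2 / 4 * INR (fact (2 * n)) ^ 2)) by field.
rewrite <- E2.
replace (2 * INR n * (wallis (2 * n) ^ 2 * K)) with
  (2 * INR n * wallis (2 * n) ^ 2 * K) by ring.
now apply Rmult_le_compat_r.
Qed.

(* The remainder X_n in n! = sqrt (2 pi n) (n/e)^n exp X_n. *)
Definition stirling_log (n : nat) : R :=
  ln (INR (fact n)) + INR n - (INR n + 1 / 2) * ln (INR n) - ln (2 * PI) / 2.

Lemma stirling_log_step (n : nat) : (1 <= n)%nat ->
  stirling_log n - stirling_log (S n)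
  = (/ / INR n + 1 / 2) * ln (1 + / INR n) - 1.
Proof.
intros Hn; assert (Hn0 : 0 < INR n) by (apply lt_0_INR; lia).
unfold stirling_log; rewrite fact_simpl, mult_INR, S_INR, Rinv_inv.
replace (1 + / INR n) with ((INR n + 1) / INR n) by (field; lra).
assert (Hf := INR_fact_lt_0 n).
rewrite (ln_mult (INR n + 1)), ln_div by lra.
field.
Qed.

Lemma stirling_log_double (n : nat) : (1 <= n)%nat ->
  stirling_log (2 * n) <= 2 * stirling_log n.
Proof.
intros Hn; assert (Hn0 : 0 < INR n) by (apply lt_0_INR; lia).
assert (Hpi := PI_RGT_0).
assert (F1 := INR_fact_lt_0 n); assert (F2 := INR_fact_lt_0 (2 * n)).
assert (F3 := pow_lt _ 4 F1); assert (F4 := pow_lt _ 2 F2).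
assert (F5 := pow_lt 16 n ltac:(lra)); assert (F6 := Rmult_lt_0_compat _ _ Hpi Hn0).
assert (H := wallis_factorial n Hn).
apply ln_le in H.
2: now apply Rmult_lt_0_compat.
rewrite !ln_mult in H by easy.
rewrite !ln_pow in H by lra.
replace 16 with (2 ^ 4) in H by ring.
rewrite ln_pow in H by lra.
unfold stirling_log; rewrite mult_INR in *; change (INR 2) with 2 in *.
change (INR 4) with (1 + 1 + 1 + 1) in *.
rewrite !ln_mult by lra; lra.
Qed.

Lemma stirling_log_lower (n k : nat) : (1 <= n)%nat ->
  stirling_log n + / INR (n + k) - / INR n <= stirling_log (n + k).
Proof.
intros Hn; induction k as [|k IH]; [rewrite Nat.add_0_r; lra|].
replace (n + S k)%nat with (S (n + k)) by lia.
assert (Hs := stirling_log_step (n + k) ltac:(lia)).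
assert (Hn0 : 0 < INR (n + k)) by (apply lt_0_INR; lia).
assert (Hu := inv_INR_one (n + k) ltac:(lia)).
assert (Hl := log1p_upper _ Hu).
replace (/ INR (n + k) / (1 + / INR (n + k))) with (/ INR (S (n + k))) in Hl
  by (rewrite S_INR; field; lra).
lra.
Qed.

(* X_n >= X_{2^k n} / 2^k and X is bounded below: let k tend to infinity. *)
Lemma stirling_log_nonneg (n : nat) : (1 <= n)%nat -> 0 <= stirling_log n.
Proof.
intros Hn.
assert (Hd : forall k, stirling_log (2 ^ k * n) <= 2 ^ k * stirling_log n).
{ induction k as [|k IH]; [simpl; rewrite Nat.add_0_r; lra|].
  replace (2 ^ S k * n)%nat with (2 * (2 ^ k * n))%nat by (simpl; lia).
  assert (H := stirling_log_double (2 ^ k * n) ltac:(assert (2 ^ k <> 0)%nat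
     by (apply Nat.pow_nonzero; lia); nia)).
  simpl pow; lra. }
assert (Hb : forall k, stirling_log n - 1 <= 2 ^ k * stirling_log n).
{ intros k; apply Rle_trans with (2 := Hd k).
  assert (H2 : (2 ^ k <> 0)%nat) by (apply Nat.pow_nonzero; lia).
  assert (H := stirling_log_lower n (2 ^ k * n - n) Hn).
  replace (n + (2 ^ k * n - n))%nat with (2 ^ k * n)%nat in H by nia.
  assert (0 < / INR (2 ^ k * n)) by (apply Rinv_0_lt_compat, lt_0_INR; nia).
  assert (H1 := inv_INR_one n Hn); lra. }
destruct (Rle_lt_dec 0 (stirling_log n)) as [|Hneg]; [easy|exfalso].
destruct (Pow_x_infinity 2 ltac:(rewrite Rabs_right; lra)
            (2 - 1 / stirling_log n)) as [k Hk].
assert (H := Hb k); assert (Hk' := Hk k ltac:(lia)).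
rewrite Rabs_right in Hk' by (apply Rle_ge, pow_le; lra).
assert (2 ^ k * stirling_log n
        <= (2 - 1 / stirling_log n) * stirling_log n) by nra.
replace ((2 - 1 / stirling_log n) * stirling_log n)
  with (2 * stirling_log n - 1) in * by (field; lra).
lra.
Qed.

Lemma log_minorant_le_stirling_log (n : nat) : (3 <= n)%nat ->
  log_minorant (/ INR n) <= stirling_log n.
Proof.
intros Hn.
assert (Hdec : forall k, stirling_log (n + k) - log_minorant (/ INR (n + k))
                         <= stirling_log n - log_minorant (/ INR n)).
{ induction k as [|k IH]; [rewrite Nat.add_0_r; lra|].
  replace (n + S k)%nat with (S (n + k)) by lia.
  assert (Hs := stirling_log_step (n + k) ltac:(lia)).
  assert (Hn0 : 0 < INR (n + k)) by (apply lt_0_INR; lia).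
  assert (Hu := inv_INR_third (n + k) ltac:(lia)).
  assert (Hl := log1p_lower _ Hu).
  replace (/ INR (n + k) / (1 + / INR (n + k))) with (/ INR (S (n + k))) in Hl
    by (rewrite S_INR; field; lra).
  lra. }
apply Rnot_lt_le; intros Hlt.
set (d := log_minorant (/ INR n) - stirling_log n) in *.
assert (Hd : 0 < d) by (unfold d; lra).
destruct (archimed_cor1 d Hd) as [N [HN HN0]].
assert (H := Hdec N).
assert (Hp := stirling_log_nonneg (n + N) ltac:(lia)).
assert (HG : log_minorant (/ INR (n + N)) <= / INR (n + N)).
{ assert (Hu := inv_INR_one (n + N) ltac:(lia)).
  set (y := / INR (n + N)) in *; unfold log_minorant.
  assert (0 <= y ^ 3) by (apply pow_le; lra).
  assert (y ^ 5 <= 1 * y).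
  { replace (y ^ 5) with (y ^ 4 * y) by ring; apply Rmult_le_compat_r; [lra|].
    rewrite <- (pow1 4); apply pow_incr; lra. }
  lra. }
assert (/ INR (n + N) <= / INR N)
  by (apply Rinv_le_contravar; [apply lt_0_INR; lia|apply le_INR; lia]).
unfold d in *; lra.
Qed.

Definition sixth_power (n : nat) : R := (INR (fact n) / (sqrt PI *
  (INR n / exp 1) ^ n)) ^ 6.

Lemma sixth_power_stirling_log (n : nat) : (1 <= n)%nat ->
  sixth_power n = 8 * INR n ^ 3 * exp (6 * stirling_log n).
Proof.
intros Hn; assert (Hn0 : 0 < INR n) by (apply lt_0_INR; lia).
assert (Hpi := PI_RGT_0); assert (He := exp_pos 1).
assert (Hf := INR_fact_lt_0 n).
assert (Hs : 0 < sqrt PI) by now apply sqrt_lt_R0.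
assert (Hq : 0 < INR n / exp 1) by now apply Rdiv_lt_0_compat.
assert (Hd : 0 < sqrt PI * (INR n / exp 1) ^ n)
  by (apply Rmult_lt_0_compat; [|apply pow_lt]; easy).
assert (Hl : ln (sqrt PI) = ln PI / 2).
{ rewrite <- (sqrt_sqrt PI) at 2 by lra; rewrite ln_mult by easy; field. }
apply ln_inv.
- apply pow_lt, Rdiv_lt_0_compat; easy.
- repeat apply Rmult_lt_0_compat; try lra; [apply exp_pos].
- unfold sixth_power.
  rewrite ln_pow by (apply Rdiv_lt_0_compat; easy).
  rewrite ln_div, ln_mult, ln_pow, ln_div, ln_exp by (try apply pow_lt; easy).
  rewrite 2!ln_mult, ln_exp, ln_pow
   by (repeat apply Rmult_lt_0_compat; try apply exp_pos; try apply pow_lt; lra).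
  replace 8 with (2 ^ 3) by ring; rewrite ln_pow by lra.
  unfold stirling_log; rewrite ln_mult by lra; rewrite Hl; simpl INR; field.
Qed.

Lemma sixth_power_lower (n : nat) : (3 <= n)%nat ->
  8 * INR n ^ 3 * stirling_minorant (/ INR n) <= sixth_power n.
Proof.
intros Hn; rewrite sixth_power_stirling_log by lia.
apply Rmult_le_compat_l.
{ assert (0 <= INR n ^ 3) by apply pow_le, pos_INR; lra. }
apply Rle_trans with (exp (6 * log_minorant (/ INR n))).
- assert (Hx := inv_INR_third n Hn); apply stirling_minorant_le_exp; lra.
- apply exp_le; assert (H := log_minorant_le_stirling_log n Hn); lra.
Qed.

Lemma sixth_power_pos (n : nat) : (1 <= n)%nat -> 0 < sixth_power n.
Proof.
intros Hn; rewrite sixth_power_stirling_log by easy.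
apply Rmult_lt_0_compat, exp_pos.
apply Rmult_lt_0_compat; [lra|apply pow_lt, lt_0_INR; lia].
Qed.

Lemma sixth_power_succ (n : nat) : (1 <= n)%nat ->
  sixth_power (S n) = sixth_power n * (exp 1 * (INR n / INR (S n)) ^ n) ^ 6.
Proof.
intros Hn; assert (Hn0 : 0 < INR n) by (apply lt_0_INR; lia).
assert (He := exp_pos 1).
assert (Hs : 0 < sqrt PI) by apply sqrt_lt_R0, PI_RGT_0.
unfold sixth_power; rewrite <- Rpow_mult_distr; f_equal.
rewrite fact_simpl, mult_INR, S_INR; unfold Rdiv.
rewrite <- tech_pow_Rmult, !Rpow_mult_distr, !pow_inv.
field.
repeat split; try apply pow_nonzero; lra.
Qed.

Lemma theta_lt (n : nat) :
  sixth_power n + (24 * INR n ^ 2 + 32 * INR n + 13) < sixth_power (S n) ->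
    theta n < theta (S n).
Proof.
intros H; unfold theta; fold (sixth_power n); fold (sixth_power (S n)); rewrite S_INR.
simpl pow in *; lra.
Qed.

Lemma ratio_minorant_le_ratio (n : nat) : (3 <= n)%nat ->
  ratio_minorant (/ INR n) <= (exp 1 * (INR n / INR (S n)) ^ n) ^ 6.
Proof.
intros Hn.
assert (Hn0 : 0 < INR n) by (apply lt_0_INR; lia).
assert (Hx := inv_INR_third n Hn).
apply Rle_trans with (1 := ratio_minorant_le_exp _ Hx); right.
assert (Hq : 0 < INR n / INR (S n)) by (rewrite S_INR; apply Rdiv_lt_0_compat; lra).
assert (Hr : 0 < exp 1 * (INR n / INR (S n)) ^ n)
  by (apply Rmult_lt_0_compat; [apply exp_pos|now apply pow_lt]).
rewrite <- (exp_ln (_ ^ 6)) by now apply pow_lt.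
rewrite ln_pow, ln_mult, ln_exp, ln_pow by (try apply exp_pos; try apply pow_lt; easy).
f_equal; rewrite (S_INR n), ln_div by lra.
replace (1 + / INR n) with ((INR n + 1) / INR n) by (field; lra).
rewrite ln_div by lra; simpl INR; field; lra.
Qed.

Lemma sixth_power_step (n : nat) : (3 <= n)%nat ->
  sixth_power n + (24 * INR n ^ 2 + 32 * INR n + 13) < sixth_power (S n).
Proof.
intros Hn.
assert (Hn0 : 0 < INR n) by (apply lt_0_INR; lia).
assert (Hx := inv_INR_third n Hn).
assert (Hx' : 0 <= / INR n <= 1 / 3) by lra.
assert (Hw := sixth_power_lower n Hn); assert (Hq := ratio_minorant_le_ratio n Hn).
assert (Hf := minorants_suffice _ Hx).
rewrite sixth_power_succ by lia.
set (q := (exp 1 * (INR n / INR (S n)) ^ n) ^ 6) in *.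
assert (Hx3 : 0 < INR n ^ 3) by (apply pow_lt; lra).
apply Rmult_lt_compat_l with (1 := Hx3) in Hf.
replace (24 * INR n ^ 2 + 32 * INR n + 13) with
  (INR n ^ 3 * (24 * / INR n + 32 * (/ INR n) ^ 2 + 13 * (/ INR n) ^ 3))
  by (field; lra).
set (x := / INR n) in *.
assert (Hs : 0 <= stirling_minorant x) by (unfold stirling_minorant; poly_third x Hx').
assert (Hp : 1 <= ratio_minorant x) by (unfold ratio_minorant; poly_third x Hx').
assert (8 * INR n ^ 3 * stirling_minorant x * (ratio_minorant x - 1) <=
  sixth_power n * (q - 1)).
{ apply Rmult_le_compat; try lra; apply Rmult_le_pos; lra. }
lra.
Qed.

(* With [T c] the Taylor polynomial of degree 7 plus [c y^8], [T c y * exp (- y)]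
   is decreasing on [0, 1] for c = 1/8! and increasing for c = 1/(7 * 7!). *)
Lemma exp_1_bounds : 2.718278 <= exp 1 <= 2.718283.
Proof.
set (T := fun c y : R => 1 + y + y ^ 2 / 2 + y ^ 3 / 6 + y ^ 4 / 24
          + y ^ 5 / 120 + y ^ 6 / 720 + y ^ 7 / 5040 + c * y ^ 8).
assert (D : forall c y, is_derive (fun y => T c y * exp (- y)) y
              (y ^ 7 * (8 * c - 1 / 5040 - c * y) * exp (- y))).
{ intros c y; unfold T; auto_derive; [easy|field]. }
assert (P7 : forall y, 0 <= y <= 1 -> 0 <= y ^ 7) by (intros; apply pow_le; lra).
assert (L : - (T (1 / 40320) 0 * exp (Ropp 0)) <= - (T (1 / 40320) 1 * exp (Ropp 1))).
{ apply (le_of_derive_nonneg (fun y => - (T (1 / 40320) y * exp (- y)))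
    (fun y => - (y ^ 7 * (8 * (1 / 40320) - 1 / 5040 - 1 / 40320 * y)
                 * exp (- y)))); [lra| |].
  - intros y Hy; apply (is_derive_opp (V := R_NormedModule)), D.
  - intros y Hy; specialize (P7 y Hy); rewrite <- Ropp_mult_distr_l_reverse.
    apply Rmult_le_pos; [nra|apply Rlt_le, exp_pos]. }
assert (U : T (1 / 35280) 0 * exp (Ropp 0) <= T (1 / 35280) 1 * exp (Ropp 1)).
{ apply (le_of_derive_nonneg _ _ 0 1 Rle_0_1 (fun y _ => D _ y)).
  intros y Hy; specialize (P7 y Hy).
  apply Rmult_le_pos; [nra|apply Rlt_le, exp_pos]. }
rewrite Ropp_0, exp_0, exp_Ropp in L, U.
assert (He := exp_pos 1).
apply Rmult_le_compat_r with (r := exp 1) in L, U; try lra.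
replace (- (T (1 / 40320) 1 * / exp 1) * exp 1) with (- T (1 / 40320) 1) in L
  by (field; lra).
replace (T (1 / 35280) 1 * / exp 1 * exp 1) with (T (1 / 35280) 1) in U
  by (field; lra).
unfold T in L, U; lra.
Qed.

(* Here the minorants are too weak, so the bound at 3 is carried back to 2 and 1
   through the exact ratios. *)
Lemma sixth_power_step_small (n : nat) : (n = 1 \/ n = 2)%nat ->
  sixth_power n + (24 * INR n ^ 2 + 32 * INR n + 13) < sixth_power (S n).
Proof.
intros Hn.
assert (W1 := sixth_power_succ 1 ltac:(lia)); assert (W2 :=
  sixth_power_succ 2 ltac:(lia)).
assert (W3 := sixth_power_lower 3 ltac:(lia)).
assert (P1 := sixth_power_pos 1 ltac:(lia)); assert (P2 :=
  sixth_power_pos 2 ltac:(lia)).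
rewrite Rpow_mult_distr in W1, W2.
assert (He := exp_1_bounds).
assert (HE : 2.718278 ^ 6 <= exp 1 ^ 6 <= 2.718283 ^ 6)
  by (split; apply pow_incr; lra).
set (E := exp 1 ^ 6) in *.
assert (sixth_power 1 * 2.718278 ^ 6 <= sixth_power 1 * E) by
  (apply Rmult_le_compat_l; lra).
assert (sixth_power 2 * 2.718278 ^ 6 <= sixth_power 2 * E) by
  (apply Rmult_le_compat_l; lra).
assert (sixth_power 2 * E <= sixth_power 2 * 2.718283 ^ 6) by
  (apply Rmult_le_compat_l; lra).
replace (INR 3) with 3 in * by (simpl; ring).
change (INR 2) with 2 in *; change (INR 1) with 1 in *.
unfold stirling_minorant in W3; destruct Hn as [-> | ->].
- change (INR 1) with 1; lra.
- change (INR 2) with 2; lra.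
Qed.

Theorem theorem1 : forall n : nat, (1 <= n)%nat -> theta n < theta (S n).
Proof.
intros n Hn; apply theta_lt.
assert (H : (3 <= n \/ n = 1 \/ n = 2)%nat) by lia.
destruct H; [now apply sixth_power_step|now apply sixth_power_step_small].
Qed.
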